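(* Let $A$ be a triangular algebra over an algebraically closed field $k$, with homological quadratic form $h_A$ and Coxeter transformation $\phi_A$. If $h_A$ is non-negative, then $A$ is of cyclotomic type. Moreover, if $h_A$ is positive definite then $\phi_A$ is diagonalizable (over $\mathbb{C}$) and periodic.
   Context: A triangular algebra is a basic connected finite dimensional $k$-algebra whose quiver has no oriented cycles. Let $n$ be the number of non-isomorphic simple $A$-modules, $K_0(A)\cong\mathbb{Z}^n$ the Grothendieck group, and $C_A$ the Cartan matrix of $A$ (invertible over $\mathbb{Z}$). The homological quadratic form is $h_A(x)=x^T(C_A^{-1}+C_A^{-T})x$ for $x\in K_0(A)$; up to the factor $2$ this is $\langle x,x\rangle$, where $\langle u,v\rangle=u^TC_A^{-1}v$ is the bilinear form with $\langle \mathbf{dim}\,X,\mathbf{dim}\,Y\rangle=\sum_{j\ge 0}(-1)^j\dim_k\mathrm{Ext}^j_A(X,Y)$. The Coxeter transformation is the automorphism $\phi_A=-C_AC_A^{-T}$ of $K_0(A)$, characterized by $\langle x,\phi_A(y)\rangle=-\langle y,x\rangle$; it is induced by the Auslander-Reiten translation of the bounded derived category of $\mathrm{mod}\,A$. $A$ is of cyclotomic type if the characteristic polynomial of $\phi_A$ is a product of cyclotomic polynomials. $\phi_A$ is periodic if $\phi_A^r=\mathrm{id}$ for some $r\ge1$. *)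

(* Defs.v *)
From HB Require Import structures.
From mathcomp Require Import all_boot all_order all_algebra all_field.
From mathcomp Require Import boolp reals.
From mathcomp Require Import complex.

Set Implicit Arguments.
Unset Strict Implicit.
Unset Printing Implicit Defensive.

Import Order.TTheory GRing.Theory Num.Theory.
Local Open Scope ring_scope.

Section Algebra.
Variables (k : fieldType) (A : falgType k).
Implicit Types (U V I J : {vspace A}) (e : A).

(* Modules are right modules. As A is a unital k-algebra, its one-sided and
   two-sided ideals are automatically k-subspaces. *)
Definition right_ideal I : bool := (I * fullv <= I)%VS.
Definition two_sided_ideal I : bool :=
  (I * fullv <= I)%VS && (fullv * I <= I)%VS.

Definition maximal_right_ideal I : Prop :=
  [/\ right_ideal I, I != fullv &
      forall J, right_ideal J -> (I <= J)%VS -> J = I \/ J = fullv].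

Definition is_jacobson_radical J : Prop :=
  forall x : A, x \in J <-> (forall I, maximal_right_ideal I -> x \in I).

Lemma jacobson_radical_exists : exists J, is_jacobson_radical J.
Proof.
suff H d U : (\dim U <= d)%N ->
    (forall x, (forall I, maximal_right_ideal I -> x \in I) -> x \in U) ->
    exists J, is_jacobson_radical J.
  by apply: (H (\dim (fullv : {vspace A})) fullv) => // x _; rewrite memvf.
elim: d U => [|d IHd] U dU sub;
  case: (pselect (forall I, maximal_right_ideal I -> (U <= I)%VS)) => [le|nle].
- by exists U => x; split=> [xU I /le/subvP|]; [apply | exact: sub].
- exfalso; apply: nle => I _; move: dU; rewrite leqn0 dimv_eq0 => /eqP ->.
  exact: sub0v.
- by exists U => x; split=> [xU I /le/subvP|]; [apply | exact: sub].
- move/existsNP: nle => [I /not_implyP [maxI /negP nUI]].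
  apply: (IHd (U :&: I)%VS) => [|x xI]; last first.
    by rewrite memv_cap sub ?xI.
  rewrite -ltnS; apply: leq_trans dU.
  rewrite ltn_neqAle dimvS ?capvSl // andbT; apply: contra nUI => /eqP eqd.
  by apply/capv_idPl/eqP; rewrite eqEdim capvSl eqd /=.
Qed.

Definition jacobson_radical : {vspace A} := sval (cid jacobson_radical_exists).

Lemma jacobson_radicalP : is_jacobson_radical jacobson_radical.
Proof. exact: svalP (cid jacobson_radical_exists). Qed.

(* e A *)
Definition proj e : {vspace A} := (<[e]> * fullv)%VS.

(* Isomorphism of right A-modules between right ideals U and V; a k-linear map
   U -> V is represented by an endomorphism of A restricted to U. *)
Definition right_module_iso U V : Prop :=
  exists f : 'End(A),
    [/\ (f @: U = V)%VS,
        (U :&: lker f = 0)%VS &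
        forall x a : A, x \in U -> f (x * a) = f x * a].

Definition primitive_idempotent e : Prop :=
  [/\ e != 0, e * e = e &
      forall f g : A, f * f = f -> g * g = g -> f * g = 0 -> g * f = 0 ->
        e = f + g -> f = 0 \/ g = 0].

Definition complete_primitive_orthogonal n (e : 'I_n -> A) : Prop :=
  [/\ forall i, primitive_idempotent (e i),
      forall i j, i != j -> e i * e j = 0 &
      \sum_i e i = 1].

(* A is not a direct product of two nonzero algebras. *)
Definition connected_algebra : Prop :=
  forall U V, two_sided_ideal U -> two_sided_ideal V ->
    (U + V = fullv)%VS -> (U :&: V = 0)%VS -> U = 0%VS \/ V = 0%VS.

Section Idempotents.
Variables (n : nat) (e : 'I_n -> A).

Definition basic_algebra : Prop :=
  forall i j, i != j -> ~ right_module_iso (proj (e i)) (proj (e j)).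

(* dim_k e_i (J / J^2) e_j with J = rad A: the space e_i (J / J^2) e_j is the
   image of e_i J e_j in J / J^2, and U :\: V is a complement of U :&: V in U. *)
Definition arrows (i j : 'I_n) : nat :=
  let J := jacobson_radical in
  \dim ((<[e i]> * J * <[e j]>) :\: (J * J))%VS.

Definition acyclic_quiver : Prop :=
  forall c : seq 'I_n, cycle [rel i j | (0 < arrows i j)%N] c -> c = [::].

Definition triangular_algebra : Prop :=
  [/\ complete_primitive_orthogonal e, basic_algebra, connected_algebra &
      acyclic_quiver].

(* dim_k e_i A e_j is the multiplicity of the simple S_j in P_i = e_i A, so the
   i-th row is dim P_i.  With this convention dim(P_i)^T C^-1 = (i-th basis
   vector)^T, hence <u, v> = u^T C^-1 v is the Euler form. *)
Definition cartan_matrix : 'M[int]_n :=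
  \matrix_(i, j) (\dim (<[e i]> * fullv * <[e j]>)%VS)%:Z.

Definition homological_form (x : 'cV[int]_n) : int :=
  let C' := invmx cartan_matrix in
  (x^T *m (C' + C'^T) *m x) 0 0.

(* Acts on column vectors of K_0(A) = Z^n. *)
Definition coxeter_matrix : 'M[int]_n :=
  - (cartan_matrix *m (invmx cartan_matrix)^T).

Definition nonnegative_form (h : 'cV[int]_n -> int) : Prop :=
  forall x, 0 <= h x.

Definition positive_definite_form (h : 'cV[int]_n -> int) : Prop :=
  forall x, x != 0 -> 0 < h x.

Definition cyclotomic_type : Prop :=
  exists s : seq nat,
    all (leq 1) s /\ char_poly coxeter_matrix = \prod_(d <- s) 'Phi_d.

End Idempotents.
End Algebra.

Definition periodic n (phi : 'M[int]_n) : Prop :=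
  exists2 r : nat, (0 < r)%N & phi ^+ r = 1%:M.

(* Every R : realType is (isomorphic to) the field of real numbers. *)
Definition diagonalizable_over_complex n (phi : 'M[int]_n) : Prop :=
  forall R : realType,
    diagonalizable (map_mx (fun z : int => z%:~R) phi : 'M[complex R]_n).

(* Main.v *)
Require Import Defs.
From HB Require Import structures.
From mathcomp Require Import all_boot all_order all_algebra all_field.
From mathcomp Require Import fingroup perm.
From mathcomp Require Import boolp reals complex.
From mathcomp Require Import ring zify.

(** The algebra enters only through one fact: its Cartan matrix [C] has
    determinant one ([det_cartan]), hence is invertible over the integers.
    Everything else is about an integral matrix [C] and the forms it defines.

    Determinant one.  Let J be the radical.  The corner rings e_i A e_i of
    primitive idempotents are local (Fitting, [primitive_corner]), so basicness
    gives e_i A e_j inside J for distinct i and j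
    ([primitive_hom_jacobson]), while algebraic closedness gives
    e_i A e_i = k e_i + e_i J e_i ([primitive_end_scalar]).  Without a
    path from i to j of positive length in the quiver, e_i J e_j lies in every
    power of J ([no_path_radical]), and J is nilpotent
    ([jacobson_nilpotent]); so e_i J e_j = 0.  As there is no oriented cycle,
    the diagonal of C is 1, and a nonzero off-diagonal entry forces a path;
    every permutation other than the identity then contributes 0 to the
    determinant ([det_acyclic]).

    Forms.  Put B = C^-1, S = B + B^T, h(x) = x^T S x and Phi = - C B^T.  Then
    Phi preserves the symmetric form S, and 1 - Phi = C S, so that Phi is the
    identity on the radical of S.  If S is non-negative, the inequalities
    h(x + y) >= 0 and h(x - y) >= 0 bound
    the integral matrices S Phi^t uniformly in t ([coxeter_orbit_bound]);
    so two of them agree, and cancelling a power of Phi gives S Phi^r = S with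
    r > 0 ([coxeter_periodic_mod_radical]).  In other words Phi has finite
    order modulo the radical of S.  Therefore (Phi - 1)(Phi^r - 1) = 0 and every
    eigenvalue is a root of unity; a monic integral polynomial with only such
    roots is a product of cyclotomic polynomials
    ([root_of_unity_cyclotomic_prod]).  If S is positive definite, it has no
    radical, so Phi^r = 1, and X^r - 1 is separable in characteristic zero
    ([periodic_diagonalizable]). *)

Set Implicit Arguments.
Unset Strict Implicit.
Unset Printing Implicit Defensive.

Import Order.TTheory GRing.Theory Num.Theory.
Local Open Scope ring_scope.

(** * Nilpotent elements *)

Definition nilpotent_elt (R : nzRingType) (x : R) : Prop :=
  exists m : nat, x ^+ m = 0.

Lemma nilpotent_mulC (R : nzRingType) (x y : R) :
  nilpotent_elt (x * y) -> nilpotent_elt (y * x).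
Proof.
move=> [m xym]; exists m.+1.
suff -> : (y * x) ^+ m.+1 = y * (x * y) ^+ m * x by rewrite xym mulr0 mul0r.
elim: m {xym} => [|m IHm]; first by rewrite !expr0 expr1 mulr1.
by rewrite exprS IHm [(x * y) ^+ m.+1]exprS !mulrA.
Qed.

Lemma nilpotent_subr1_rinv (R : nzRingType) (x : R) :
  nilpotent_elt x -> exists b, (1 - x) * b = 1.
Proof.
move=> [m xm]; exists (\sum_(i < m) x ^+ i).
by apply: oppr_inj; rewrite -mulNr opprB -subrX1 xm sub0r.
Qed.

(** * The radical of a finite dimensional algebra *)

Section FiniteDimensionalAlgebra.
Variables (k : fieldType) (A : falgType k).
Implicit Types (x y e : A) (U V I : {vspace A}).

Lemma prodv_lineP x U y :
  y \in (<[x]> * U)%VS -> exists2 u, u \in U & y = x * u.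
Proof.
have: (<[x]> * U <= amull x @: U)%VS.
  apply/prodvP => _ u /vlineP[c ->] uU.
  apply/memv_imgP; exists (c *: u); first by rewrite memvZ.
  by rewrite lfunE /= -scalerAr scalerAl.
by move/subvP/(_ y) => H /H /memv_imgP[u uU ->]; exists u; rewrite ?lfunE.
Qed.

Lemma prodv_sandwichP x z U y :
  y \in (<[x]> * U * <[z]>)%VS -> exists2 u, u \in U & y = x * u * z.
Proof.
rewrite -prodvA => /prodv_lineP[w]; rewrite -limg_amulr => /memv_imgP[u uU ->] ->.
by exists u; rewrite // lfunE /= mulrA.
Qed.

(** In dimension d, the power x^d lies in the span of 1, x, ..., x^(d-1). *)
Lemma annihilating_poly x : exists2 p : {poly k}, p != 0 & horner_alg x p = 0.
Proof.
have /subvP/(_ (x ^+ \dim {:A})) := subX_agenv <[x]>%VS (\dim {:A}).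
rewrite expv_line memv_line => /(_ isT) /memv_sumP[v vP xE].
have /choice[c cP] : forall i : 'I_(\dim {:A}), exists c, v i = c *: x ^+ i.
  by move=> i; have := vP i isT; rewrite expv_line => /vlineP.
exists ('X^(\dim {:A}) - \sum_(i < \dim {:A}) c i *: 'X^i).
  apply/eqP => /(congr1 (fun p : {poly k} => p`_(\dim {:A}))) /eqP.
  rewrite coefB coefXn eqxx coef_sum coef0 big1 ?subr0 ?oner_eq0 // => i _.
  by rewrite coefZ coefXn gtn_eqF ?mulr0.
rewrite linearB /= linear_sum /= rmorphXn /= horner_algX xE -sumrB big1 // => i _.
by rewrite linearZ /= rmorphXn /= horner_algX cP mulr_algl subrr.
Qed.

(** Write an annihilating polynomial of x as q X^m with q(0) nonzero; the
    Bezout relation u q + v X^(m+1) = 1, multiplied by X^(m+1), gives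
    h = v(x) x^m.  This is the Fitting decomposition of multiplication by x. *)
Lemma strongly_pi_regular x :
  exists (m : nat) (h : A), x * h = h * x /\ x ^+ m.+1 = x ^+ m.+1 * (x * h).
Proof.
have [p p0 px] := annihilating_poly x.
have [m [q]] := multiplicity_XsubC p 0; rewrite p0 /= subr0 => q0 pE.
have : coprimep q 'X by rewrite coprimepX.
move/(coprimep_expr m.+1)/Bezout_eq1_coprimepP => [[u v] /= uv].
exists m, (horner_alg x (v * 'X^m)).
have {}uv : 'X^(m.+1) = u * 'X * p + 'X^(m.+1) * ('X * (v * 'X^m)).
  by rewrite -{1}[_ ^+ _]mulr1 -uv pE !exprS; ring.
split.
  by rewrite -{1 4}(horner_algX x) -[LHS]rmorphM -[RHS]rmorphM [in LHS]mulrC.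
have := congr1 (horner_alg x) uv.
by rewrite rmorphD !rmorphM !rmorphXn /= !horner_algX px mulr0 add0r.
Qed.

Lemma right_idealM I x a : right_ideal I -> x \in I -> x * a \in I.
Proof. by move=> /subvP rI xI; apply/rI/memv_mul; rewrite ?memvf. Qed.

Lemma right_ideal_line x : right_ideal (<[x]> * fullv)%VS.
Proof. by rewrite /right_ideal -prodvA prodvSr ?subvf. Qed.

Lemma right_ideal_mem1 I : right_ideal I -> 1 \in I -> I = fullv.
Proof.
move=> rI I1; apply/eqP; rewrite eqEsubv subvf; apply/subvP => a _.
by rewrite -[a]mul1r right_idealM.
Qed.

Lemma maximal_right_ideal_exists I :
  right_ideal I -> I != fullv ->
  exists2 M, maximal_right_ideal M & (I <= M)%VS.
Proof.
elim: {I}_.+1 {-2}I (ltnSn (\dim {:A} - \dim I)) => // d IHd I dI rI nI.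
case: (pselect (maximal_right_ideal I)) => [maxI|]; first by exists I.
case/not_and3P => // /existsNP[K /not_implyP[rK /not_implyP[IK]]].
case/not_orP => /eqP nKI /eqP nKf.
have dIK : (\dim I < \dim K)%N.
  rewrite ltn_neqAle dimvS // andbT; apply: contra nKI => /eqP dE.
  by rewrite eq_sym eqEdim IK dE /=.
have [|M maxM KM] := IHd K _ rK nKf.
  rewrite -ltnS; apply: leq_trans dI; rewrite ltnS ltn_sub2l //.
  exact: leq_trans dIK (dimvS (subvf K)).
by exists M => //; apply: subv_trans KM.
Qed.

Notation J := (jacobson_radical A).

Lemma jacobson_right_ideal : right_ideal J.
Proof.
apply/prodvP => x a xJ _; apply/jacobson_radicalP => I maxI.
have [rI _ _] := maxI.
by apply: right_idealM => //; move/jacobson_radicalP: xJ; apply.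
Qed.

(** Otherwise (1 - x)A would lie in a maximal right ideal, which contains x and
    hence 1. *)
Lemma jacobson_subr1_rinv x : x \in J -> exists b, (1 - x) * b = 1.
Proof.
move=> /jacobson_radicalP xJ.
have [full|proper] := eqVneq (<[1 - x]> * fullv)%VS fullv.
  have : 1 \in (<[1 - x]> * fullv)%VS by rewrite full memvf.
  by case/prodv_lineP => b _ /esym; exists b.
have [M maxM /subvP leM] :=
  maximal_right_ideal_exists (right_ideal_line _) proper.
have [rM /negP[]] := maxM; apply/eqP/right_ideal_mem1 => //.
rewrite -[1](subrK x) memvD ?xJ // leM // -[X in X \in _]mulr1.
by rewrite memv_mul ?memv_line ?memvf.
Qed.

Lemma jacobson_expv_sub m : (J ^+ m.+1 <= J)%VS.
Proof.
rewrite expvSl; apply: subv_trans jacobson_right_ideal.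
by rewrite prodvSr ?subvf.
Qed.

(** Let V be a power of J of least dimension, so V V = V.  If V were nonzero,
    choose x with x V nonzero of least dimension, and y in V with x y V nonzero:
    then x y V = x V contains x y, so x y = x y v with v in J, and x y = 0
    because 1 - v is right invertible. *)
Lemma jacobson_nilpotent : exists m, (J ^+ m.+1 = 0)%VS.
Proof.
have exd : exists d, `[< exists m, \dim (J ^+ m.+1) = d >].
  by exists (\dim J); apply/asboolP; exists 0%N; rewrite expv1.
have [d /asboolP[m dm] min_d] := ex_minnP exd; exists m.
pose V : {vspace A} := (J ^+ m.+1)%VS.
have VV : (V * V = V)%VS.
  rewrite -expvD; apply/eqP; rewrite eqEdim dm min_d; last first.
    by apply/asboolP; exists (m + m.+1)%N.
  rewrite andbT expvD; apply: subv_trans (prodvSr _ (jacobson_expv_sub m)) _.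
  rewrite /V expvSr -prodvA prodvSr //.
  by apply: subv_trans jacobson_right_ideal; rewrite prodvSr ?subvf.
apply/eqP; apply: contraT => V0.
have exx : exists d, `[< exists x, (<[x]> * V != 0)%VS /\ \dim (<[x]> * V) = d >].
  exists (\dim (<[1]> * V)); apply/asboolP; exists 1; split=> //.
  by rewrite prod1v.
have [c /asboolP[x [xV0 dx]] min_c] := ex_minnP exx.
have [y yV xyV] : exists2 y, y \in V & (<[x * y]> * V != 0)%VS.
  apply: contrapT => ny; case/negP: xV0; rewrite -VV prodvA -subv0.
  apply/prodvP => _ v /prodv_lineP[y yV ->] vV.
  have [xyV|] := eqVneq (<[x * y]> * V)%VS 0%VS; last first.
    by move=> xyV; case: ny; exists y.
  by rewrite -xyV memv_mul ?memv_line.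
have xyE : (<[x * y]> * V = <[x]> * V)%VS.
  apply/eqP; rewrite eqEdim dx min_c; last by apply/asboolP; exists (x * y).
  rewrite andbT -{2}VV prodvA prodvSl // -memvE.
  by rewrite memv_mul ?memv_line.
have : x * y \in (<[x * y]> * V)%VS by rewrite xyE memv_mul ?memv_line.
case/prodv_lineP => v vV xyv.
have vJ : v \in J by apply: subvP (jacobson_expv_sub m) _ _.
have [b vb] := jacobson_subr1_rinv vJ.
case/negP: xyV; suff -> : x * y = 0 by rewrite prod0v.
by rewrite -[x * y]mulr1 -vb mulrA mulrBr mulr1 -xyv subrr mul0r.
Qed.

(** If a maximal right ideal I misses x, then 1 = u + x a with u in I; but
    u = 1 - x a is right invertible when x a is nilpotent.  Since x (b a) and
    (a x) b are nilpotent together, the criterion shows that the intersection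
    of the maximal right ideals is also a left ideal. *)
Lemma mem_jacobsonP x : x \in J <-> forall a, nilpotent_elt (x * a).
Proof.
split=> [xJ a|nil_x].
  have [m Jm] := jacobson_nilpotent; exists m.+1.
  apply/eqP; rewrite -memv0 -Jm memvE -expv_line.
  by apply: expvS; rewrite -memvE right_idealM ?jacobson_right_ideal.
apply/jacobson_radicalP => I [rI nI maxI].
have [|IxI|IxI] := maxI (I + <[x]> * fullv)%VS _ (addvSl _ _).
- rewrite /right_ideal prodvDl; apply: addvS => //; exact: right_ideal_line.
- rewrite -IxI; apply: subvP (addvSr _ _) _ _.
  by rewrite -[X in X \in _]mulr1 memv_mul ?memv_line ?memvf.
have : 1 \in (I + <[x]> * fullv)%VS by rewrite IxI memvf.
case/memv_addP => u uI [_ /prodv_lineP[a _ ->] u1].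
have [b] := nilpotent_subr1_rinv (nil_x a).
rewrite {1}u1 addrK => ub; case/negP: nI; apply/eqP/right_ideal_mem1 => //.
by rewrite -ub right_idealM.
Qed.

Lemma jacobson_mull a x : x \in J -> a * x \in J.
Proof.
move=> xJ; apply/mem_jacobsonP => b.
rewrite -mulrA; apply: nilpotent_mulC; rewrite -mulrA.
by move/mem_jacobsonP: xJ; apply.
Qed.

End FiniteDimensionalAlgebra.

(** * Primitive idempotents and the radical *)

Section PrimitiveIdempotents.
Variables (k : fieldType) (A : falgType k).
Implicit Types (x y e : A).
Notation J := (jacobson_radical A).

(** Fitting's lemma in the corner ring eAe: with h as in
    [strongly_pi_regular], g = x^(m+1) h^(m+1) is an idempotent of eAe, and
    x is nilpotent or invertible according to whether g = 0 or g = e. *)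
Lemma primitive_corner e x :
  primitive_idempotent e -> e * x = x -> x * e = x ->
  nilpotent_elt x \/
  exists y, [/\ e * y = y, y * e = y, x * y = e & y * x = e].
Proof.
move=> [_ ee prim_e] ex xe.
have [m [h [xh xm]]] := strongly_pi_regular x.
set g := x ^+ m.+1 * h ^+ m.+1.
have gC : g = h ^+ m.+1 * x ^+ m.+1 by apply/commrX/commr_sym/commrX.
have eg : e * g = g by rewrite /g exprS !mulrA ex.
have ge : g * e = g by rewrite gC [x ^+ _]exprSr -!mulrA xe.
have xg : x ^+ m.+1 * g = x ^+ m.+1.
  rewrite /g -exprMn_comm //.
  elim: {2}m.+1 => [|p IHp]; first by rewrite mulr1.
  by rewrite [(x * h) ^+ p.+1]exprS mulrA -xm.
have gg : g * g = g.
  have hg : h ^+ m.+1 * g = g * h ^+ m.+1 by rewrite {1}/g mulrA -gC.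
  by rewrite {1}/g -mulrA hg mulrA xg.
have [fe0|g0] : e - g = 0 \/ g = 0.
- apply: prim_e => //.
  + by rewrite mulrBl !mulrBr ee eg ge gg subrr subr0.
  + by rewrite mulrBl eg gg subrr.
  + by rewrite mulrBr ge gg subrr.
  + by rewrite subrK.
- right; exists (e * x ^+ m * h ^+ m.+1 * e).
  have eE : x ^+ m.+1 * h ^+ m.+1 = e by rewrite -/g; apply/esym/subr0_eq.
  split; first by rewrite !mulrA ee.
  + by rewrite -!mulrA ee.
  + by rewrite !mulrA xe -exprS eE ee.
  + have hx : h ^+ m.+1 * x = x * h ^+ m.+1.
      by apply: commr_sym; apply: commrX.
    by rewrite -!mulrA ex hx [x ^+ m * _]mulrA -exprSr eE ee.
- by left; exists m.+1; rewrite -xg g0 mulr0.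
Qed.

(** The products x a and x a e = (x a) e are nilpotent together, because
    x a = e (x a). *)
Lemma corner_nil_jacobson e x :
  e * x = x -> (forall a, nilpotent_elt (x * a * e)) -> x \in J.
Proof.
move=> ex nil_x; apply/mem_jacobsonP => a.
by rewrite -[x]ex -mulrA; apply: nilpotent_mulC.
Qed.

(** For x in eAf outside J some x a e is invertible in eAe.  So x has a right
    inverse y in fAe, and y x is a nonzero idempotent of fAf, which is f by
    primitivity; then left multiplication by y is an isomorphism eA -> fA. *)
Lemma primitive_hom_jacobson e f x :
  primitive_idempotent e -> primitive_idempotent f ->
  ~ right_module_iso (proj e) (proj f) ->
  e * x = x -> x * f = x -> x \in J.
Proof.
move=> pe pf niso ex xf; have [e0 ee _] := pe; have [_ ff prim_f] := pf.
apply: (corner_nil_jacobson ex) => a.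
have [||//|[w [ew we xw _]]] := @primitive_corner e (x * a * e) pe.
- by rewrite !mulrA ex.
- by rewrite -!mulrA ee.
case: niso; pose y := f * a * w.
have xy : x * y = e by rewrite /y !mulrA xf -{1}ew !mulrA.
have fy : f * y = y by rewrite /y !mulrA ff.
have ye : y * e = y by rewrite /y -!mulrA we.
clearbody y.
have yxyx : (y * x) * (y * x) = y * x.
  by rewrite -mulrA [x * (y * x)]mulrA xy ex.
have yxf : y * x * f = y * x by rewrite -mulrA xf.
have fyx : f * (y * x) = y * x by rewrite mulrA fy.
have yx : y * x = f.
  have [] : y * x = 0 \/ f - y * x = 0.
  - apply: prim_f => //.
    + by rewrite mulrBl !mulrBr yxyx ff yxf fyx subrr subr0.
    + by rewrite mulrBr yxyx yxf subrr.
    + by rewrite mulrBl yxyx fyx subrr.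
    + by rewrite addrC subrK.
  - move=> yx0; case/eqP: e0.
    by rewrite -ee -{1}xy -{1}xy mulrA -[x * y * x]mulrA yx0 mulr0 mul0r.
  - by move=> fB0; apply/esym/subr0_eq.
exists (amull y); split=> [||u a' _]; last by rewrite !lfunE /= mulrA.
- apply/eqP; rewrite eqEsubv; apply/andP; split; apply/subvP => v.
  + case/memv_imgP => _ /prodv_lineP[b _ ->] ->; rewrite lfunE /= mulrA ye -fy.
    by rewrite -mulrA memv_mul ?memv_line ?memvf.
  + case/prodv_lineP => b _ ->; apply/memv_imgP; exists (x * b).
      by rewrite -ex -mulrA memv_mul ?memv_line ?memvf.
    by rewrite lfunE /= mulrA yx.
- apply/eqP; rewrite -subv0; apply/subvP => v; rewrite memv_cap memv_ker.
  case/andP => /prodv_lineP[b _ ->]; rewrite lfunE /= => /eqP yeb.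
  by rewrite memv0 -{1}ee -{1}xy -!mulrA yeb mulr0.
Qed.

(** A nilpotent x in eAe has no right inverse in eAe, so no x a e is
    invertible in eAe. *)
Lemma primitive_end_nil_jacobson e x :
  primitive_idempotent e -> e * x = x -> x * e = x ->
  nilpotent_elt x -> x \in J.
Proof.
move=> pe ex xe [m xm]; have [e0 ee _] := pe.
apply: (corner_nil_jacobson ex) => a.
have [||//|[w [ew we xw _]]] := @primitive_corner e (x * a * e) pe.
- by rewrite !mulrA ex.
- by rewrite -!mulrA ee.
case/eqP: e0; have: x ^+ m * e = 0 by rewrite xm mul0r.
elim: m {xm} => [|m IHm]; first by rewrite mul1r.
move=> xm; apply: IHm; rewrite -xw.
rewrite -[x in x * a]xe !mulrA -exprSr xm.
by rewrite !mul0r.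
Qed.

End PrimitiveIdempotents.

(** Some x - c e is not invertible in eAe, because an annihilating polynomial
    of x splits into linear factors; it is then nilpotent, hence in J. *)
Lemma primitive_end_scalar (k : closedFieldType) (A : falgType k) (e x : A) :
  primitive_idempotent e -> e * x = x -> x * e = x ->
  exists c : k, x - c *: e \in jacobson_radical A.
Proof.
move=> pe ex xe; have [e0 ee _] := pe.
have ec c : e * (x - c *: e) = x - c *: e by rewrite mulrBr ex -scalerAr ee.
have ce c : (x - c *: e) * e = x - c *: e by rewrite mulrBl xe -scalerAl ee.
suff [c nil_c] : exists c : k, nilpotent_elt (x - c *: e).
  by exists c; exact: (primitive_end_nil_jacobson pe (ec c) (ce c)) nil_c.
apply: contrapT => no_nil.
have inv c : exists2 y, e * y = y & (x - c *: e) * y = e.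
  have [nil_c|[y [ey _ xy _]]] := primitive_corner pe (ec c) (ce c).
    by case: no_nil; exists c.
  by exists y.
have [p p0 px] := annihilating_poly x.
have [r pE] := closed_field_poly_normal p.
have [y yE] : exists y, horner_alg x (\prod_(z <- r) ('X - z%:P)) * e * y = e.
  elim: r {pE} => [|c r [y yE]].
    by exists e; rewrite big_nil rmorph1 mul1r ee.
  have [z ez cz] := inv c; exists (z * y).
  rewrite big_cons mulrC rmorphM rmorphB /= horner_algX horner_algC.
  rewrite -[_ * e]mulrA mulrBl xe -scalerAl mul1r.
  by rewrite mulrA -[_ * _ * z]mulrA cz.
case/eqP: e0; rewrite -yE.
have -> : horner_alg x (\prod_(z <- r) ('X - z%:P)) = 0; last by rewrite !mul0r.
apply/eqP; move: px; rewrite pE linearZ /= mulr_algl => /eqP.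
by rewrite scaler_eq0 lead_coef_eq0 (negPf p0).
Qed.

(** * Determinants of matrices supported on an acyclic relation *)

(** Joined by a path of positive length: [connect] allows the empty path. *)
Definition reach (T : finType) (r : rel T) : rel T :=
  fun i j => [exists l, r i l && connect r l j].

Lemma reachP (T : finType) (r : rel T) i j :
  reflect (exists2 l, r i l & connect r l j) (reach r i j).
Proof.
by apply: (iffP existsP) => -[l]; [case/andP | move=> il lj]; exists l; rewrite ?il.
Qed.

Lemma reach_trans (T : finType) (r : rel T) : transitive (reach r).
Proof.
move=> j i l /reachP[i' ii' i'j] /reachP[j' jj' j'l].
apply/reachP; exists i' => //.
exact: connect_trans i'j (connect_trans (connect1 jj') j'l).
Qed.

Lemma reach_irr (T : finType) (r : rel T) :
  (forall c, path.cycle r c -> c = [::]) -> irreflexive (reach r).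
Proof.
move=> acyc i; apply: contraTF isT => /reachP[l il /connectP[p lp iE]].
suff /acyc : path.cycle r (l :: p) by [].
by rewrite /= rcons_path lp -iE.
Qed.

(** If s moves i and all entries (j, s j) are nonzero, then i is related to
    s i, to s (s i), and so on, hence to i itself after #[s] steps. *)
Lemma det_acyclic (R : comNzRingType) n (M : 'M[R]_n) (r : rel 'I_n) :
  transitive r -> irreflexive r ->
  (forall i, M i i = 1) -> (forall i j, i != j -> ~~ r i j -> M i j = 0) ->
  \det M = 1.
Proof.
move=> tr irr M1 M0; rewrite /determinant (bigD1 1%g) //= odd_perm1 mul1r.
rewrite big1 => [|i _]; last by rewrite perm1.
rewrite big1 ?addr0 // => s s1.
have [i si] : exists i, s i != i.
  apply/existsP; apply: contraNT s1; rewrite negb_exists => /forallP fix_s.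
  by apply/eqP/permP => i; rewrite perm1; have := fix_s i; rewrite negbK => /eqP.
case: (pickP (fun j => (j != s j) && ~~ r j (s j))) => [j /andP[jsj nr]|all_r].
  by rewrite (bigD1 j) //= M0 // mul0r mulr0.
have step j : j = s j \/ r j (s j).
  by have := all_r j; case: eqVneq => [|_ /negbFE]; [left | right].
have orb m : r i ((s ^+ m.+1)%g i).
  elim: m => [|m IHm].
    by rewrite expg1; case: (step i) => // iE; rewrite -iE eqxx in si.
  rewrite expgSr permM; case: (step ((s ^+ m.+1)%g i)) => [<- //|].
  exact: tr.
by have := orb #[s]%g.-1; rewrite prednK ?order_gt0 // expg_order perm1 irr.
Qed.

(** * The Cartan matrix of a triangular algebra *)

Section Triangular.
Variables (k : closedFieldType) (A : falgType k) (n : nat) (e : 'I_n -> A).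
Hypothesis triA : triangular_algebra e.
Notation J := (jacobson_radical A).
Notation path_rel := (reach [rel i j | (0 < arrows e i j)%N]).

Lemma triangular_prim i : primitive_idempotent (e i).
Proof. by have [[]] := triA. Qed.

Lemma triangular_idem i : e i * e i = e i.
Proof. by have [] := triangular_prim i. Qed.

(** Without an arrow from i to j, the space e_i J e_j lies in J^2, so it is
    contained in the sum over l of (e_i J e_l)(e_l J e_j).  For each l one of
    the two factors joins vertices without a path, and induction applies to
    it. *)
Lemma no_path_radical m i j :
  ~~ path_rel i j -> (<[e i]> * J * <[e j]> <= J ^+ m.+1)%VS.
Proof.
have subJ a b : (<[e a]> * J * <[e b]> <= J)%VS.
  apply/subvP => _ /prodv_sandwichP[z zJ ->].
  by rewrite right_idealM ?jacobson_mull //; apply: jacobson_right_ideal.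
elim: m i j => [|m IHm] i j nij; first by rewrite expv1 subJ.
have idem l : (<[e l]> * <[e l]> = <[e l]>)%VS.
  by rewrite prodv_line triangular_idem.
have EJJ : (<[e i]> * J * <[e j]> <= J * J)%VS.
  rewrite -diffv_eq0 -dimv_eq0 -leqn0 leqNgt; apply: contra nij => a_ij.
  by apply/reachP; exists j.
have EE : (<[e i]> * J * <[e j]> = <[e i]> * (<[e i]> * J * <[e j]>) * <[e j]>)%VS.
  by rewrite -!prodvA idem !prodvA idem.
rewrite EE; apply: subv_trans (prodvSl _ (prodvSr _ EJJ)) _.
rewrite !prodvA -[(_ * J * <[e j]>)%VS]prodvA; apply/prodvP => x y xP yP.
have [[_ _ e1] _ _ _] := triA.
rewrite -[x]mulr1 -e1 mulr_sumr mulr_suml; apply: memv_suml => l _.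
rewrite -triangular_idem mulrA -[x * e l * e l * y]mulrA.
have xl : x * e l \in (<[e i]> * J * <[e l]>)%VS by rewrite memv_mul ?memv_line.
have yl : e l * y \in (<[e l]> * J * <[e j]>)%VS.
  by rewrite -prodvA memv_mul ?memv_line.
have [il|nil] := boolP (path_rel i l).
  have nlj : ~~ path_rel l j by apply: contra nij; apply: reach_trans.
  rewrite expvSl; apply: memv_mul; first exact: subvP (subJ _ _) _ xl.
  exact: subvP (IHm _ _ nlj) _ yl.
rewrite expvSr; apply: memv_mul; last exact: subvP (subJ _ _) _ yl.
exact: subvP (IHm _ _ nil) _ xl.
Qed.

Lemma no_path_hom0 i j x :
  ~~ path_rel i j -> x \in J -> e i * x * e j = 0.
Proof.
move=> nij xJ; have [m Jm] := jacobson_nilpotent A.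
apply/eqP; rewrite -memv0 -Jm; apply: subvP (no_path_radical m nij) _ _.
by rewrite !memv_mul ?memv_line.
Qed.

Lemma no_path_refl i : ~~ path_rel i i.
Proof. by have [_ _ _ acyc] := triA; rewrite reach_irr. Qed.

Lemma cartan_diag i : cartan_matrix e i i = 1.
Proof.
rewrite mxE; suff -> : (<[e i]> * fullv * <[e i]> = <[e i]>)%VS.
  by have [e0 _ _] := triangular_prim i; rewrite dim_vline e0.
apply/eqP; rewrite eqEsubv; apply/andP; split; apply/subvP => x.
  case/prodv_sandwichP => a _ ->; set y := e i * a * e i.
  have ey : e i * y = y by rewrite /y !mulrA triangular_idem.
  have ye : y * e i = y by rewrite /y -!mulrA triangular_idem.
  have [c yJ] := primitive_end_scalar (triangular_prim i) ey ye.
  have := no_path_hom0 (no_path_refl i) yJ.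
  rewrite mulrBr mulrBl ey ye -scalerAr -scalerAl !triangular_idem.
  by move/subr0_eq ->; rewrite memvZ ?memv_line.
case/vlineP => c ->; rewrite memvZ // -[X in X \in _]triangular_idem.
by rewrite -[X in X * _]mulr1 !memv_mul ?memv_line ?memvf.
Qed.

Lemma cartan_offdiag i j : i != j -> ~~ path_rel i j -> cartan_matrix e i j = 0.
Proof.
move=> ij nij; rewrite mxE; suff -> : (<[e i]> * fullv * <[e j]> = 0)%VS.
  by rewrite dimv0.
apply/eqP; rewrite -subv0; apply/subvP => x /prodv_sandwichP[a _ ->].
set y := e i * a * e j.
have ey : e i * y = y by rewrite /y !mulrA triangular_idem.
have ye : y * e j = y by rewrite /y -!mulrA triangular_idem.
have [_ basic _ _] := triA.
have yJ : y \in J.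
  by apply: primitive_hom_jacobson (basic i j ij) ey ye; apply: triangular_prim.
by rewrite -ey -ye mulrA no_path_hom0 ?mem0v.
Qed.

Lemma det_cartan : \det (cartan_matrix e) = 1.
Proof.
apply: (det_acyclic (r := path_rel)).
- exact: reach_trans.
- by move=> i; apply/negbTE/no_path_refl.
- exact: cartan_diag.
- exact: cartan_offdiag.
Qed.

End Triangular.

(** * Bounded sequences of integral matrices *)

Lemma pigeonhole_nat (T : finType) (f : nat -> T) :
  exists s r, f (s + r.+1)%N = f s.
Proof.
have /injectivePn[i [j ij fij]] : ~~ injectiveb (fun i : 'I_#|T|.+1 => f i).
  by apply/injectiveP => /leq_card; rewrite card_ord ltnn.
wlog lt_ij : i j ij fij / (i < j)%N.
  move=> H; case: (ltngtP i j) => [|/[dup] ji|/val_inj eij]; first exact: H ij fij.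
    by apply: H; rewrite // eq_sym.
  by rewrite eij eqxx in ij.
by exists i, (j - i).-1; rewrite prednK ?subn_gt0 // subnKC // ltnW.
Qed.

Lemma bounded_int_mx_recurrent m n (f : nat -> 'M[int]_(m, n)) (K : nat) :
  (forall t i j, `|f t i j| <= K%:Z) -> exists s r, f (s + r.+1)%N = f s.
Proof.
move=> bound.
(* Shifting by K embeds the entries into {0, ..., 2K}. *)
pose g t : 'M['I_(2 * K).+1]_(m, n) := \matrix_(i, j) inord `|(f t i j + K%:Z)%R|%N.
have [s [r gE]] := pigeonhole_nat g; exists s, r.
apply/matrixP => i j; move/matrixP/(_ i j): gE; rewrite !mxE.
move/(congr1 val); have := bound s i j; have := bound (s + r.+1)%N i j.
by move=> b1 b2; rewrite /= !inordK; lia.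
Qed.

(** * The Coxeter transformation of a unimodular matrix *)

Section IntegralForm.
Variables (n : nat) (C : 'M[int]_n).
Hypothesis C_unit : C \in unitmx.
Notation B := (invmx C).
Notation S := (B + B^T).
Notation Phi := (- (C *m B^T)).

Lemma coxeter_sub1 : 1%:M - Phi = C *m S.
Proof. by rewrite opprK mulmxDr mulmxV. Qed.

Lemma coxeter_unit : Phi \in unitmx.
Proof.
by rewrite -mulNmx unitmx_mul -scaleN1r unitmxZ // C_unit unitmx_tr unitmx_inv.
Qed.

Lemma coxeter_isometry : Phi^T *m S *m Phi = S.
Proof.
have BPhi : B *m Phi = - B^T by rewrite mulmxN mulmxA mulVmx // mul1mx.
have PB : Phi^T *m B *m Phi = B.
  by rewrite -mulmxA BPhi mulmxN -trmx_mul BPhi linearN /= trmxK opprK.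
have := congr1 trmx PB; rewrite !trmx_mul trmxK mulmxA => PBt.
by rewrite mulmxDr mulmxDl PB PBt.
Qed.

Lemma coxeterX_isometry t : (Phi ^+ t)^T *m S *m Phi ^+ t = S.
Proof.
elim: t => [|t IHt]; first by rewrite expr0 trmx1 mul1mx mulmx1.
rewrite exprS -mulmxE trmx_mul -[RHS]IHt -[in RHS]coxeter_isometry.
by rewrite !mulmxA.
Qed.

Definition integral_form (x : 'cV[int]_n) : int := (x^T *m S *m x) 0 0.

Hypothesis form_ge0 : forall x, 0 <= integral_form x.

(** The entry (i, j) of S Phi^t is the value of the bilinear form S at the basis
    vector x = e_i and y = Phi^t e_j, where h(y) = h(e_j) because Phi is an
    isometry; the bound is h(x + y) >= 0 and h(x - y) >= 0. *)
Lemma coxeter_orbit_bound t i j :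
  `|(S *m Phi ^+ t) i j| <= S i i + S j j.
Proof.
pose x : 'cV[int]_n := delta_mx i 0.
pose y : 'cV[int]_n := Phi ^+ t *m delta_mx j 0.
have deltaE (M : 'M[int]_n) a b :
    ((delta_mx a 0 : 'cV_n)^T *m (M *m (delta_mx b 0 : 'cV_n))) 0 0 = M a b.
  by rewrite trmx_delta mulmxA -rowE -colE !mxE.
have St : S^T = S by rewrite linearD /= trmxK addrC.
have hx : x^T *m (S *m x) = (S i i)%:M.
  by apply/matrixP=> a b; rewrite !ord1 [RHS]mxE mulr1n deltaE.
have hy : y^T *m (S *m y) = (S j j)%:M.
  apply/matrixP=> a b; rewrite !ord1 [RHS]mxE mulr1n -[RHS]deltaE.
  by rewrite -[in RHS](coxeterX_isometry t) /y trmx_mul !mulmxA.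
have hxy : x^T *m (S *m y) = ((S *m Phi ^+ t) i j)%:M.
  by apply/matrixP=> a b; rewrite !ord1 [RHS]mxE mulr1n /y [S *m (_ *m _)]mulmxA deltaE.
have hyx : y^T *m (S *m x) = ((S *m Phi ^+ t) i j)%:M.
  by apply: trmx_inj; rewrite tr_scalar_mx -hxy trmx_mul
    [(S *m x)^T]trmx_mul trmxK St -mulmxA.
have plus : integral_form (x + y) = S i i + S j j + 2 * (S *m Phi ^+ t) i j.
  rewrite /integral_form -mulmxA linearD /= mulmxDl !(mulmxDr _ x).
  rewrite !(mulmxDr _ (S *m x)) hx hy hxy hyx !mxE /=.
  by ring.
have minus : integral_form (x - y) = S i i + S j j - 2 * (S *m Phi ^+ t) i j.
  rewrite /integral_form -mulmxA linearB /= mulmxBl !(mulmxBr _ x).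
  rewrite !(mulmxBr _ (S *m x)) hx hy hxy hyx !mxE /=.
  by ring.
have := form_ge0 (x + y); have := form_ge0 (x - y); rewrite plus minus.
lia.
Qed.

(** The columns of S Phi^r = S say that Phi^r is the identity modulo the
    radical of S. *)
Lemma coxeter_periodic_mod_radical : exists2 r : nat, (0 < r)%N & S *m Phi ^+ r = S.
Proof.
pose K := (\sum_i `|S i i|)%N.
have Kle i : S i i <= K%:Z.
  by rewrite /K (bigD1 i) //=; lia.
have [t i j|s [r rE]] :=
  @bounded_int_mx_recurrent n n (fun t => S *m Phi ^+ t) (2 * K)%N.
  apply: le_trans (coxeter_orbit_bound t i j) _.
  by rewrite mul2n -addnn PoszD; apply: lerD; apply: Kle.
exists r.+1 => //; move: rE; rewrite addnC exprD -mulmxE mulmxA.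
apply: (can_inj (mulmxK _)).
elim: s => [|s IHs]; first by rewrite expr0 unitmx1.
by rewrite exprS -mulmxE unitmx_mul coxeter_unit.
Qed.

Lemma coxeter_annihilator :
  exists2 r : nat, (0 < r)%N & (Phi - 1%:M) *m (Phi ^+ r - 1%:M) = 0.
Proof.
have [r r0 Sr] := coxeter_periodic_mod_radical; exists r => //.
rewrite -opprB coxeter_sub1 mulNmx -mulmxA mulmxBr Sr mulmx1 subrr mulmx0.
by rewrite oppr0.
Qed.

Lemma coxeter_periodic :
  (forall x, x != 0 -> 0 < integral_form x) -> periodic Phi.
Proof.
move=> form_gt0; have [r r0 Sr] := coxeter_periodic_mod_radical; exists r => //.
apply/eqP; rewrite -subr_eq0; apply/eqP/matrixP => i j.
set D := Phi ^+ r - 1%:M; have SD : S *m D = 0.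
  by rewrite mulmxBr Sr mulmx1 subrr.
have [D0|/form_gt0] := eqVneq (col j D) 0.
  by have /matrixP/(_ i 0) := D0; rewrite !mxE.
rewrite /integral_form -mulmxA [X in S *m X]colE [S *m _]mulmxA SD.
by rewrite mul0mx mulmx0 mxE ltxx.
Qed.

End IntegralForm.

(** * Eigenvalues that are roots of unity *)

(** A root z of p is a primitive m-th root of unity for some m, and 'Phi_m is
    its minimal polynomial over the rationals.  So the remainder of p modulo
    the monic 'Phi_m, which has z as a root and smaller degree, is zero; then
    divide and repeat. *)
Lemma root_of_unity_cyclotomic_prod (p : {poly int}) :
  p \is monic ->
  (forall z : algC, root (map_poly intr p) z ->
     exists2 r : nat, (0 < r)%N & z ^+ r = 1) ->
  exists s : seq nat, all (leq 1) s /\ p = \prod_(d <- s) 'Phi_d.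
Proof.
have [d] := ubnP (size p); elim: d p => // d IHd p sp mon_p rt_p.
have [/eqP/size_poly1P[c c0 pE]|sp1] := eqVneq (size p) 1%N.
  exists [::]; rewrite big_nil; split=> //.
  by move: mon_p; rewrite pE monicE lead_coefC => /eqP ->.
have inj_intr : injective (intr : int -> algC) by exact: intr_inj.
have /closed_rootP[z pz] : size (map_poly (intr : int -> algC) p) != 1%N.
  by rewrite size_map_inj_poly.
have [r r_gt0 zr] := rt_p z pz.
have [m prim_z _] := prim_order_exists r_gt0 zr.
have monPhi := Cyclotomic_monic m.
pose q := (p %/ 'Phi_m)%R; pose t := (p %% 'Phi_m)%R.
have pE : p = q * 'Phi_m + t := Pdiv.IdomainMonic.divp_eq monPhi p.
have rootPhi : root (map_poly intr 'Phi_m) z.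
  by rewrite (Cintr_Cyclotomic prim_z) root_cyclotomic.
have t0 : t = 0.
  have [p0 [Dp0 _] dv_p0] := minCpolyP z.
  have size_p0 : size p0 = size 'Phi_m.
    rewrite size_Cyclotomic -(size_cyclotomic z m) -(minCpoly_cyclotomic prim_z).
    by rewrite Dp0 size_map_poly.
  have inj_intrQ : injective (intr : int -> rat) by exact: intr_inj.
  have p0_t : p0 %| map_poly (intr : int -> rat) t.
    rewrite -dv_p0 -map_poly_comp (eq_map_poly (ratr_int _)).
    move: pz rootPhi; rewrite pE rmorphD rmorphM !rootE hornerD hornerM /=.
    by move=> + /eqP Phi0; rewrite Phi0 mulr0 add0r.
  apply: (map_inj_poly inj_intrQ) => //; rewrite rmorph0.
  apply: contraTeq isT => /dvdp_leq/(_ p0_t); rewrite size_p0.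
  rewrite size_map_inj_poly // leqNgt /t.
  by rewrite ltn_modp monic_neq0.
have {}pE : p = q * 'Phi_m by rewrite [LHS]pE t0 addr0.
have mon_q : q \is monic by rewrite -(monicMr _ monPhi) -pE.
have size_Phi : (1 < size 'Phi_m)%N.
  by rewrite size_Cyclotomic ltnS totient_gt0 (prim_order_gt0 prim_z).
have [||s [s_gt0 qE]] := IHd q _ mon_q.
- rewrite -ltnS; apply: leq_trans sp; rewrite ltnS pE size_Mmonic ?monic_neq0 //.
  by rewrite -subn1 -addnBA ?(ltnW size_Phi) // -[X in (X < _)%N]addn0 ltn_add2l
    subn_gt0.
- move=> w qw; apply: rt_p; rewrite pE rmorphM rootM /=.
  by rewrite qw.
exists (m :: s); split; first by rewrite /= (prim_order_gt0 prim_z).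
by rewrite big_cons pE qE mulrC.
Qed.

Lemma char_poly_root_of_unity n (M : 'M[int]_n.+1) (r : nat) :
  (M - 1%:M) *m (M ^+ r - 1%:M) = 0 ->
  forall z : algC, root (map_poly intr (char_poly M)) z -> z ^+ r = 1.
Proof.
move=> Mr z; rewrite map_char_poly -eigenvalue_root_char => /eigenvalueP[v vM v0].
have := congr1 (map_mx (intr : int -> algC)) Mr.
rewrite map_mxM !map_mxB !map_mx1 map_mx0 => /(congr1 (mulmx v)).
rewrite mulmxA [v *m _]mulmxBr vM mulmx1 -{2}[v]scale1r -scalerBl.
rewrite -scalemxAl mulmxBr mulmx1.
have -> : v *m map_mx intr (M ^+ r) = z ^+ r *: v.
  elim: r {Mr} => [|r IHr]; first by rewrite !expr0 map_mx1 mulmx1 scale1r.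
  by rewrite exprSr -mulmxE map_mxM mulmxA IHr -scalemxAl vM scalerA -exprSr.
rewrite mulmx0 -{2}[v]scale1r -scalerBl scalerA => /eqP.
rewrite scaler_eq0 (negPf v0) orbF mulf_eq0 !subr_eq0 => /orP[/eqP-> | /eqP//].
by rewrite expr1n.
Qed.

Lemma periodic_diagonalizable n (M : 'M[int]_n.+1) :
  periodic M -> diagonalizable_over_complex M.
Proof.
move=> [r r_gt0 Mr] R; set M' := map_mx _ M.
apply/diagonalizableP.
have [rs rsE] := closed_field_poly_normal ('X^r - 1 : {poly complex R}).
rewrite (monicP (monic_Xn_sub_1 _ r_gt0)) scale1r in rsE.
exists rs.
  rewrite -separable_prod_XsubC -rsE separable_Xn_sub_1 // pnatr_eq0.
  by rewrite -lt0n.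
rewrite -rsE; apply: mxminpoly_min.
rewrite rmorphB rmorphXn rmorph1 /= horner_mx_X.
have -> : M' ^+ r = 1; last by rewrite subrr.
by rewrite /M' -rmorphXn /= Mr map_mx1.
Qed.

(** * Proof of the theorem *)

Theorem mainTheorem3 (k : closedFieldType) (A : falgType k)
    (n : nat) (e : 'I_n -> A) :
  triangular_algebra e ->
  (nonnegative_form (homological_form e) -> cyclotomic_type e) /\
  (positive_definite_form (homological_form e) ->
     diagonalizable_over_complex (coxeter_matrix e) /\
     periodic (coxeter_matrix e)).
Proof.
case: n e => [|n] e triA.
  have [[_ _ /esym/eqP]] := triA.
  by rewrite big_ord0 oner_eq0.
have C_unit : cartan_matrix e \in unitmx by rewrite unitmxE det_cartan // unitr1.
split=> [form_ge0 | form_gt0].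
  have [r r_gt0 ann] := coxeter_annihilator C_unit form_ge0.
  apply: root_of_unity_cyclotomic_prod (char_poly_monic _) _ => z z_root.
  by exists r => //; apply: char_poly_root_of_unity ann z z_root.
have form_ge0 x : 0 <= homological_form e x.
  have [->|/form_gt0/ltW //] := eqVneq x 0.
  by rewrite /homological_form mulmx0 mxE.
have per : periodic (coxeter_matrix e) := coxeter_periodic C_unit form_ge0 form_gt0.
by split; first exact: periodic_diagonalizable.
Qed.
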